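(* Let $\sum_{k=1}^{\infty} a_k z^k$ be a power series (with $a_k \in \mathbb{C}$) that converges uniformly on the unit circle $\mathbb{T}$ to a continuous function $f$ such that $\lambda(\{z \in \mathbb{T} : \operatorname{Re} f(z) = 0\}) = 0$. Let $D = \{k \in \mathbb{N} : a_k \neq 0\}$. Then \[ \alpha(D) \leq \min(\rho_+(f), \rho_-(f)). \]
   Context: $\mathbb{N} = \{1,2,\ldots\}$; $\lambda$ is the normalized Lebesgue measure on $\mathbb{T} = \{z \in \mathbb{C} : |z| = 1\}$ with $\lambda(\mathbb{T}) = 1$. For continuous $f\colon \mathbb{T} \to \mathbb{C}$, $\rho_+(f) = \lambda(\{z \in \mathbb{T} : \operatorname{Re} f(z) > 0\})$ and $\rho_-(f) = \lambda(\{z \in \mathbb{T} : \operatorname{Re} f(z) < 0\})$. For a finite set $E \subset \mathbb{N}$ and $n \geq 1$, the circulant graph $G_n$ with set of distances $E$ has vertex set $\{0, \ldots, n-1\}$, vertices $u, v$ (possibly equal) being adjacent iff $u - v \equiv d$ or $v - u \equiv d \pmod n$ for some $d \in E$; $\alpha(G)$ is the maximum size of an independent set (no two adjacent vertices, no looped vertex); $\alpha(E) := \lim_{n\to\infty} \alpha(G_n)/n$ (which exists). For an arbitrary $D \subseteq \mathbb{N}$, $\alpha(D) := \inf_n \alpha(D \cap \{1, \ldots, n\})$. *)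

(* Defs.v *)
From HB Require Import structures.
From mathcomp Require Import all_boot all_order all_algebra.
From mathcomp Require Import all_classical all_reals all_analysis.
From mathcomp Require Import complex.
Set Implicit Arguments. Unset Strict Implicit. Unset Printing Implicit Defensive.
Import Order.TTheory GRing.Theory Num.Theory.
Import numFieldNormedType.Exports.
Local Open Scope classical_set_scope.
Local Open Scope ring_scope.

(* S is an independent set of the circulant graph G_n with distances E:
   no u, v in S (possibly equal) with u - v = d (mod n), d in E
   (the case v - u = d is covered by swapping u and v). *)
Definition circ_indep (E : seq nat) (n : nat) (S : {set 'I_n}) : bool :=
  [forall u in S, forall v in S, all (fun d => ~~ (val u == val v + d %[mod n])) E].

Definition alphaG (E : seq nat) (n : nat) : nat :=
  \max_(S : {set 'I_n} | circ_indep E S) #|S|.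

(* alpha(E) := lim_{n -> oo} alpha(G_n)/n  (for finite E; the limit exists) *)
Definition alphaE {R : realType} (E : seq nat) : R :=
  lim ((fun n : nat => (alphaG E n)%:R / n%:R : R) @ \oo).

Definition trunc_set (D : pred nat) (n : nat) : seq nat :=
  [seq k <- iota 1 n | D k].

Definition alphaD {R : realType} (D : pred nat) : R :=
  inf [set (alphaE (trunc_set D n) : R) | n in [set n : nat | (0 < n)%N]].

Definition on_circle {R : realType} (z : R[i]) : Prop := ComplexField.Normc.normc z = 1.

Definition expi {R : realType} (t : R) : R[i] :=
  (cos (2 * pi * t) +i* sin (2 * pi * t))%C.

(* normalized Lebesgue measure on T, via the parametrization [0,1) -> T *)
Definition lambdaT {R : realType} (A : set R[i]) : \bar R :=
  (@lebesgue_measure R) [set t : R | (0 <= t < 1) /\ A (expi t)].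

Definition rho_plus {R : realType} (f : R[i] -> R[i]) : \bar R :=
  lambdaT [set z | on_circle z /\ 0 < complex.Re (f z)].
Definition rho_minus {R : realType} (f : R[i] -> R[i]) : \bar R :=
  lambdaT [set z | on_circle z /\ complex.Re (f z) < 0].

Definition psum {R : realType} (a : nat -> R[i]) (N : nat) (z : R[i]) : R[i] :=
  \sum_(1 <= k < N.+1) a k * z ^+ k.

(* Main.v *)
(* The bound on the graphs G_n is the inertia bound. Weighting the edges of G_n
   by the a_k gives a circulant Hermitian matrix whose eigenvalues are
   2 Re p(w^j), where p is the truncated power series and w = exp(2 pi i / n);
   an independent set is a totally isotropic coordinate subspace, so its size is
   at most the number of j with Re p(w^j) >= 0. Since p is uniformly close to f,
   these j satisfy Re f(w^j) > - e, and by uniform continuity their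
   proportion is at most the measure of {Re f >= - 2 e}. Letting e tend to 0
   gives rho_+(f), the zero set of Re f being negligible; rho_-(f) is obtained
   by replacing f by - f. *)
Require Import Defs.
From HB Require Import structures.
From mathcomp Require Import all_boot all_order all_algebra.
From mathcomp Require Import all_classical all_reals all_analysis.
From mathcomp Require Import complex.
From mathcomp Require Import ring lra zify.
Import Order.TTheory GRing.Theory Num.Theory.
Import numFieldNormedType.Exports.
Local Open Scope classical_set_scope.
Local Open Scope ring_scope.

(** * Roots of unity and the discrete Fourier transform *)

Lemma expi0 (R : realType) : expi (0 : R) = 1.
Proof. by rewrite /expi mulr0 cos0 sin0. Qed.

Lemma expiD (R : realType) (s t : R) : expi (s + t) = expi s * expi t.
Proof.
rewrite /expi mulrDr cosD sinD; apply/eqP; rewrite eq_complex /=.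
by rewrite eqxx /= addrC eqxx.
Qed.

Lemma expiMn (R : realType) (t : R) (n : nat) : expi (t * n%:R) = expi t ^+ n.
Proof.
elim: n => [|n IH]; first by rewrite mulr0 expi0.
by rewrite -natr1 mulrDr mulr1 expiD IH exprSr.
Qed.

Lemma normc_expi (R : realType) (t : R) : on_circle (expi t).
Proof. by rewrite /on_circle /= cos2Dsin2 sqrtr1. Qed.

Lemma mul_conj_normc (R : realType) (x : R[i]) :
  x * x^* = (ComplexField.Normc.normc x ^+ 2)%:C%C.
Proof. by case: x => c d; rewrite -normCK normc_def -rmorphXn. Qed.

Lemma expi_conj (R : realType) (t : R) : (expi t)^* = (expi t)^-1.
Proof.
have E : expi t * (expi t)^* = 1.
  by rewrite mul_conj_normc normc_expi expr1n.
have nz : expi t != 0.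
  by apply: contraTneq (oner_neq0 R[i]) => z; rewrite -E z mul0r eqxx.
by apply: (mulfI nz); rewrite E mulfV.
Qed.

Lemma expi_neq1 (R : realType) (t : R) : 0 < t < 1 -> expi t != 1.
Proof.
move=> /andP[t0 t1]; rewrite eq_complex /= negb_and; apply/orP; left.
(* With half the angle, [cos (2 * pi * t)] is [1 - 2 * sin (pi * t) ^+ 2], and this sine is positive
   as [pi * t] lies in [(0, pi)]. *)
have -> : 2 * pi * t = (pi * t) *+ 2 by rewrite -mulrA mulr_natl.
rewrite cos_mulr2n cos2sin2.
have s0 : 0 < sin (pi * t).
  apply: sin_gt0_pi; rewrite mulr_gt0 ?pi_gt0 //=.
  by rewrite -[ltRHS]mulr1 ltr_pM2l ?pi_gt0.
have := exprn_gt0 2 s0; apply: contraTneq => E; rewrite -leNgt.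
by move: E; lra.
Qed.

Lemma expi_nat (R : realType) (n : nat) : expi (n%:R : R) = 1.
Proof.
have -> : n%:R = (1 * n%:R : R) by rewrite mul1r.
rewrite expiMn.
suff -> : expi (1 : R) = 1 by rewrite expr1n.
by rewrite /expi mulr1 mulr_natl cos2pi sin2pi.
Qed.

(** Orthogonality of characters: exchanging the roles of [j] and [m] gives a geometric sum of ratio
    [expi (m / n)], which is 1 only if [n] divides [m]. *)
Lemma sum_expi (R : realType) (n m : nat) : (0 < n)%N ->
  \sum_(j < n) expi (j%:R / n%:R : R) ^+ m = if (n %| m)%N then n%:R else 0.
Proof.
move=> n0; have n0' : (n%:R : R) != 0 by rewrite pnatr_eq0 -lt0n.
have -> : \sum_(j < n) expi (j%:R / n%:R : R) ^+ m
    = \sum_(j < n) expi (m%:R / n%:R : R) ^+ j.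
  by apply: eq_bigr => j _; rewrite -!expiMn; congr expi; ring.
case: ifP => [/dvdnP[q ->]|ndvd].
  rewrite natrM mulfK // expi_nat.
  under eq_bigr do rewrite expr1n.
  by rewrite sumr_const card_ord.
have z1 : expi (m%:R / n%:R : R) != 1.
  rewrite (divn_eq m n) natrD natrM mulrDl mulfK // expiD expi_nat mul1r.
  apply: expi_neq1; rewrite divr_gt0 ?ltr0n //=; last by rewrite lt0n -[_ == _]/(n %| m)%N ndvd.
  by rewrite ltr_pdivrMr ?ltr0n // mul1r ltr_nat ltn_mod.
apply: (mulfI (x := expi (m%:R / n%:R : R) - 1)); first by rewrite subr_eq0.
by rewrite -subrX1 -expiMn divfK // expi_nat subrr mulr0.
Qed.

(** Expanding the square gives powers of [z j] with exponent [u s - u t + k]; summation over [j]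
    keeps the pairs whose exponent is divisible by [n]. *)
Lemma dft_autocorrelation (R : realType) (p n k : nat) (u : 'I_p -> 'I_n)
    (y : 'I_p -> R[i]) (z := fun j : 'I_n => expi (j%:R / n%:R : R))
    (X := fun j : 'I_n => \sum_s y s * z j ^+ u s) :
  \sum_j X j * (X j)^* * z j ^+ k =
  n%:R * \sum_s \sum_(t | u s + k == u t %[mod n]) y s * (y t)^*.
Proof.
case: n u @z @X => [|n] u z X; first by rewrite big_ord0 mul0r.
(* The complement [n.+1 - u t] stands for [- u t], as [z j] is a root of unity of order dividing
   [n.+1]; this keeps exponents natural. *)
pose e (s t : 'I_p) := (u s + (n.+1 - u t) + k)%N.
have zX j s t : z j ^+ u s * (z j ^+ u t)^* * z j ^+ k = z j ^+ e s t.
  have zn : z j ^+ n.+1 = 1 by rewrite /z -expiMn divfK ?pnatr_eq0 // expi_nat.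
  have ut : (u t <= n.+1)%N by apply: ltnW.
  have nz : z j ^+ u t != 0.
    by apply/expf_neq0/eqP => z0; have := oner_neq0 R[i]; rewrite -zn z0 expr0n eqxx.
  rewrite rmorphXn /= expi_conj /e !exprD; congr (_ * _ * _).
  by apply: (mulfI nz); rewrite -exprD subnKC // zn exprVn mulfV.
transitivity (\sum_j \sum_s \sum_t y s * (y t)^* * z j ^+ e s t).
  apply: eq_bigr => j _; rewrite /X rmorph_sum /= mulr_suml mulr_suml.
  apply: eq_bigr => s _; rewrite mulr_sumr mulr_suml.
  by apply: eq_bigr => t _; rewrite -zX rmorphM /=; ring.
rewrite exchange_big mulr_sumr; apply: eq_bigr => s _.
rewrite exchange_big mulr_sumr [RHS]big_mkcond /=; apply: eq_bigr => t _.
rewrite -mulr_sumr sum_expi //.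
have -> : (n.+1 %| e s t)%N = (u s + k == u t %[mod n.+1]).
  rewrite -(eqn_modDr (n.+1 - u t)) subnKC; last exact: ltnW.
  by rewrite modnn /dvdn /e addnAC.
by case: ifP => _; rewrite ?mulr0 // mulrC.
Qed.

(** * The inertia bound *)

Lemma Re_sum (R : realType) (I : Type) (r : seq I) (P : pred I) (F : I -> R[i]) :
  complex.Re (\sum_(i <- r | P i) F i) = \sum_(i <- r | P i) complex.Re (F i).
Proof. by apply: (big_morph (@complex.Re R)) => // -[? ?] [? ?]. Qed.

Lemma underdetermined_solution (F : fieldType) (m n : nat) (A : 'M[F]_(m, n)) :
  (n < m)%N -> exists2 x : 'rV_m, x *m A = 0 & x != 0.
Proof.
move=> nm.
have : kermx A != 0.
  by rewrite kermx_eq0 /row_free neq_ltn (leq_ltn_trans (rank_leq_col A)).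
by case/rowV0Pn => x /sub_kermxP xA x0; exists x.
Qed.

(* If [#|S|] exceeded the right-hand side, some nonzero [y] supported on [S]
   would have a discrete Fourier transform [X] vanishing wherever the
   trigonometric polynomial has nonnegative real part; but the autocorrelation
   of [y] vanishes on [E], so the sum of [|X|^2] against the polynomial is [0]. *)
Lemma circ_indep_inertia (R : realType) (E : seq nat) (a : nat -> R[i]) (n : nat)
    (S : {set 'I_n}) : circ_indep E S ->
  leq #|S| #|[pred j : 'I_n |
    0 <= complex.Re (\sum_(k <- E) a k * expi (j%:R / n%:R : R) ^+ k)]|.
Proof.
move=> indS; set J := [pred j | _]; rewrite leqNgt; apply/negP => JS.
pose z (j : 'I_n) := expi (j%:R / n%:R : R).
pose u (s : 'I_#|S|) := enum_val s.
(* The entries of [y] are [#|S|] unknowns, subject to the [#|J|] equations [X j = 0] for [j] in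
   [J]. *)
have [y yA y0] := underdetermined_solution _ _ _
  (\matrix_(s < #|S|, j < #|J|) (z (enum_val j) ^+ u s)) JS.
pose X j := \sum_s y 0 s * z j ^+ u s.
have XJ j : j \in J -> X j = 0.
  move=> jJ; have /rowP/(_ (enum_rank_in jJ j)) := yA.
  rewrite !mxE => <-; apply: eq_bigr => s _.
  by rewrite mxE enum_rankK_in.
have E0 k : k \in E -> \sum_j X j * (X j)^* * z j ^+ k = 0.
  move=> kE; rewrite dft_autocorrelation big1 ?mulr0 // => s _.
  rewrite big_pred0 // => t; apply/negbTE.
  move: indS => /forall_inP/(_ _ (enum_valP t))/forall_inP/(_ _ (enum_valP s)).
  by move=> /allP/(_ _ kE); rewrite eq_sym.
pose q j := \sum_(k <- E) a k * z j ^+ k.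
have q0 : \sum_j X j * (X j)^* * q j = 0.
  under eq_bigr do rewrite mulr_sumr.
  rewrite exchange_big big_seq big1 //= => k kE.
  transitivity (a k * \sum_j X j * (X j)^* * z j ^+ k).
    by rewrite mulr_sumr; apply: eq_bigr => j _; ring.
  by rewrite E0 // mulr0.
pose N x := ComplexField.Normc.normc (x : R[i]).
(* The sign makes every term nonnegative: [X] vanishes on [J], and [Re (q j) < 0] off [J]. Hence
   every term is zero. *)
have Re0 : \sum_j - (N (X j) ^+ 2 * complex.Re (q j)) = 0.
  rewrite sumrN; apply/eqP; rewrite oppr_eq0; apply/eqP.
  transitivity (complex.Re (\sum_j X j * (X j)^* * q j)); last by rewrite q0.
  rewrite Re_sum; apply: eq_bigr => j _; rewrite mul_conj_normc.
  by case: (q j) => c d /=; rewrite mul0r subr0.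
have X0 j : X j = 0.
  have [/XJ//|jJ] := boolP (j \in J).
  have qj : complex.Re (q j) < 0 by move: jJ; rewrite /J inE -ltNge.
  have /eqP := Re0; rewrite psumr_eq0 => [/allP/(_ j (mem_index_enum _))|i _].
    rewrite oppr_eq0 mulf_eq0 (lt_eqF qj) orbF expf_eq0 /= => /eqP.
    exact: ComplexField.Normc.eq0_normc.
  have [/XJ ->|iJ] := boolP (i \in J).
    by rewrite /N ComplexField.Normc.normc0 expr0n mul0r oppr0.
  rewrite oppr_ge0; apply: mulr_ge0_le0; first exact: sqr_ge0.
  by move: iJ; rewrite /J inE -ltNge => /ltW.
have n0 : (0 < n)%N.
  have : (0 < #|S|)%N by apply: leq_ltn_trans JS.
  by case/card_gt0P => i _; apply: leq_ltn_trans (ltn_ord i).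
(* Shift 0 is Parseval's identity: [X = 0] forces the sum of [|y s|^2] to vanish. *)
have : \sum_j X j * (X j)^* * z j ^+ 0 = _ := dft_autocorrelation _ _ _ 0 u (y 0).
rewrite big1 => [|j _]; last by rewrite X0 !mul0r.
move/esym/eqP; rewrite mulf_eq0 pnatr_eq0 -leqn0 leqNgt n0 /=.
under eq_bigr => s _.
  rewrite (big_pred1 s) => [|t]; last first.
    by rewrite addn0 !modn_small // val_eqE (inj_eq enum_val_inj) eq_sym.
  rewrite -normCK; over.
rewrite psumr_eq0 => [/allP h|s _]; last exact: exprn_ge0.
case/eqP: y0; apply/rowP => s; rewrite mxE.
by have := h s (mem_index_enum _); rewrite expf_eq0 /= normr_eq0 => /eqP.
Qed.

(** * Continuity on the circle and sampling at equally spaced points *)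

Lemma normc_le_ReIm (R : rcfType) (x : R[i]) :
  ComplexField.Normc.normc x <= `|complex.Re x| + `|complex.Im x|.
Proof.
case: x => c d /=; have cd0 : 0 <= `|c| + `|d| by rewrite addr_ge0.
rewrite -(ger0_norm cd0) -(sqrtr_sqr (_ + _)).
rewrite ler_sqrt ?sqr_ge0 // sqrrD !real_normK ?num_real // addrAC lerDl.
by rewrite mulrn_wge0 ?mulr_ge0.
Qed.

Lemma Re_le_normc (R : rcfType) (x : R[i]) :
  `|complex.Re x| <= ComplexField.Normc.normc x.
Proof. by rewrite -lecR; have := normc_ge_Re x; rewrite normc_def; case: x. Qed.

Lemma continuous_Re_expi (R : realType) (f : R[i] -> R[i]) :
  (forall z : R[i], on_circle z -> forall e : R, 0 < e ->
     exists2 d : R, 0 < d & forall w : R[i], on_circle w ->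
       ComplexField.Normc.normc (w - z) < d ->
       ComplexField.Normc.normc (f w - f z) < e) ->
  continuous (fun t : R => complex.Re (f (expi t))).
Proof.
move=> fc t; apply/cvgrPdist_lt => e e0.
have [d d0 fd] := fc _ (normc_expi R t) _ e0.
(* One half of [d] bounds the cosine difference, the other the sine difference. *)
have d20 : 0 < d / 2 by rewrite divr_gt0.
have lin : {for t, continuous (fun s : R => 2 * pi * s)}.
  by apply: cvgMr; exact: cvg_id.
have cc : {for t, continuous (fun s : R => cos (2 * pi * s))}.
  by apply: continuous_comp lin _; exact: continuous_cos.
have sc : {for t, continuous (fun s : R => sin (2 * pi * s))}.
  by apply: continuous_comp lin _; exact: continuous_sin.
have /cvgrPdist_lt/(_ _ d20) {}cc := cc.
have /cvgrPdist_lt/(_ _ d20) {}sc := sc.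
near=> s.
have h : ComplexField.Normc.normc (f (expi s) - f (expi t)) < e.
  apply: fd; first exact: normc_expi.
  apply: (le_lt_trans (normc_le_ReIm _ _)) => /=.
  rewrite (splitr d); apply: ltrD; rewrite distrC; near: s; assumption.
apply: le_lt_trans h; apply: le_trans (Re_le_normc _ _).
by rewrite distrC; case: (f (expi s)) => ? ?; case: (f (expi t)).
Unshelve. all: by end_near. Qed.

Lemma segment_uniformly_continuous (R : realType) (g : R -> R) (a b e : R) :
  continuous g -> 0 < e -> exists2 d : R, 0 < d &
    forall x y : R, a <= x <= b -> `|x - y| < d -> `|g x - g y| < e.
Proof.
move=> gc e0.
(* Compactness turns a radius valid near each point into one valid on the whole segment; the radius
   runs along the filter of positive [d] tending to 0. *)
have /compact_near_coveringP/(_ R 0^'+ (fun d x =>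
  forall y, `|x - y| < d -> `|g x - g y| < e)) := segment_compact (a := a) (b := b).
case.
- move=> x _; have e20 : 0 < e / 2 by rewrite divr_gt0.
  have /cvgrPdist_lt/(_ _ e20)/nbhs_ballP[r r0 gr] := gc x.
  have r20 : 0 < r / 2 by rewrite divr_gt0.
  exists (ball x (r / 2), [set d | d < r / 2]) => /=.
    split; first exact: nbhsx_ballx.
    exact: nbhs_right_lt.
  move=> -[x' d] /= [xx' dr] y x'y.
  have bx' : `|x - x'| < r / 2 by exact: xx'.
  have h1 : `|g x - g x'| < e / 2.
    by apply: gr; apply: (lt_trans bx'); rewrite ltr_pdivrMr // ltr_pMr // ltr1n.
  have h2 : `|g x - g y| < e / 2.
    apply: gr; rewrite /= /ball /=; apply: (le_lt_trans (ler_distD x' _ _)).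
    by rewrite (splitr r); apply: ltrD => //; apply: lt_trans dr.
  apply: (le_lt_trans (ler_distD (g x) _ _)).
  by rewrite (splitr e); apply: ltrD => //; rewrite distrC.
- move=> d0 /= d0p h.
  exists (d0 / 2); first by rewrite divr_gt0.
  move=> x y xab; apply: (h (d0 / 2)) => //=.
  + by rewrite /ball /= sub0r normrN gtr0_norm ?divr_gt0 // gtr_pMr // invf_lt1 // ltr1n.
  + by rewrite divr_gt0.
Qed.

(** Each [j] in [P] contributes an interval of length [1 / n] contained in [A], and these intervals
    are disjoint. *)
Lemma card_div_le_measure (R : realType) (n : nat) (P : pred 'I_n) (A : set R) :
  (0 < n)%N -> measurable A ->
  (forall (j : 'I_n) (t : R), P j ->
     j%:R / n%:R <= t < j.+1%:R / n%:R -> A t) ->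
  ((#|P|%:R / n%:R)%:E <= lebesgue_measure A)%E.
Proof.
move=> n0 mA PA.
pose F (i : nat) : set R :=
  if [exists j : 'I_n, (i == j) && P j] then `[i%:R / n%:R, i.+1%:R / n%:R[%classic
  else set0.
have nR : 0 < (n%:R : R) by rewrite ltr0n.
have mF i : measurable (F i) by rewrite /F; case: ifP.
have tF : trivIset setT F.
  apply/trivIsetP => i j _ _ ij; rewrite -subset0 /F => t [].
  case: ifP => // _; case: ifP => // _ /=.
  rewrite !in_itv /= => /andP[it ti] /andP[jt tj].
  have := le_lt_trans it tj; have := le_lt_trans jt ti.
  rewrite !ltr_pM2r ?invr_gt0 // !ltr_nat => ? ?.
  by move/eqP: ij; apply; lia.
have muF (i : 'I_n) : lebesgue_measure (F i) = (if P i then n%:R^-1 else 0)%:E.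
  have Pi : [exists j : 'I_n, ((i : nat) == j) && P j] = P i :> bool.
    apply/existsP/idP => [[j /andP[/eqP/val_inj ->]]//|Pi].
    by exists i; rewrite eqxx.
  rewrite /F Pi; case: (P i); last by rewrite measure0.
  rewrite lebesgue_measure_itv /= lte_fin ltr_pM2r ?invr_gt0 // ltr_nat ltnSn.
  by rewrite -EFinB -mulrBl -natr1 addrAC subrr add0r mul1r.
have -> : ((#|P|%:R / n%:R)%:E = lebesgue_measure (\big[setU/set0]_(i < n) F i))%E.
  rewrite measure_bigsetU //.
  rewrite (eq_bigr _ (fun i _ => muF i)).
  by rewrite sumEFin -big_mkcond sumr_const /= mulr_natl.
apply: le_measure; rewrite ?inE //.
  by apply: bigsetU_measurable => i _; exact: mF.
move=> t; rewrite -bigcup_mkord => -[i /= ilt]; rewrite /F.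
case: ifP => // /existsP[j /andP[/eqP -> Pj]] /=.
by rewrite in_itv /= => ?; exact: PA Pj _.
Qed.

(** * From graph bounds to measures *)

Lemma alphaE_ge0 (R : realType) (E : seq nat) : 0 <= (alphaE E : R).
Proof.
rewrite /alphaE; set u := (fun n : nat => _).
have [cu|ncu] := pselect (cvg (u @ \oo)); last by rewrite dvgP.
by apply: limr_ge => //; near=> n; rewrite divr_ge0.
Unshelve. all: by end_near. Qed.

(* [lim] is [0] on divergent sequences, so the existence of the limit is not needed. *)
Lemma alphaE_le (R : realType) (E : seq nat) (c : R) : 0 <= c ->
  (\forall n \near \oo, (alphaG E n)%:R / n%:R <= c) -> alphaE E <= c.
Proof.
move=> c0 h; rewrite /alphaE; set u := (fun n : nat => _).
have [cu|ncu] := pselect (cvg (u @ \oo)); last by rewrite dvgP.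
exact: limr_le.
Qed.

(** Indices with zero coefficient drop out, so the inertia bound for the truncated distance set
    applies to the partial sum itself. *)
Lemma psum_trunc_set (R : realType) (a : nat -> R[i]) (N : nat) (z : R[i]) :
  psum a N z =
  \sum_(k <- trunc_set (fun k => (0 < k)%N && (a k != 0)) N) a k * z ^+ k.
Proof.
rewrite /psum /trunc_set big_filter /index_iota subSS subn0.
rewrite [LHS]big_seq [RHS]big_seq_cond [RHS]big_mkcondr /=.
apply: eq_bigr => k; rewrite mem_iota => /andP[k0 _]; rewrite k0 /=.
by case: ifPn => // /negPn/eqP ->; rewrite mul0r.
Qed.

(** The threshold is [e + e]: one [e] for replacing the partial sum by [f] at a sample point, one
    for moving from that point along an arc of length [1 / n]. *)
Lemma alphaE_trunc_le_measure (R : realType) (a : nat -> R[i])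
    (f : R[i] -> R[i]) (N : nat) (e : R) :
  let g := fun t : R => complex.Re (f (expi t)) in
  continuous g -> 0 < e ->
  (forall z : R[i], on_circle z ->
     ComplexField.Normc.normc (psum a N z - f z) < e) ->
  ((alphaE (trunc_set (fun k => (0 < k)%N && (a k != 0)) N) : R)%:E <=
   lebesgue_measure (`[0%R, 1%R[ `&` [set t : R | (- (e + e) <= g t)%R]))%E.
Proof.
move=> g gc e0 fN; set A := (A in lebesgue_measure A).
set E := trunc_set _ N.
have mA : measurable A.
  apply: measurableI => //; rewrite -[X in measurable X]setTI.
  rewrite (_ : [set t | _] = g @^-1` `[- (e + e), +oo[); last first.
    by apply/seteqP; split => t /=; rewrite in_itv /= andbT.
  exact: (measurable_realfun.continuous_measurable_fun gc).
(* Finiteness of the measure allows the comparison with the real limit [alphaE] to be made in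
   [R]. *)
have A1 : (lebesgue_measure A <= 1%:E)%E.
  have -> : 1%:E = lebesgue_measure (`[0, 1[%classic : set R).
    by rewrite lebesgue_measure_itv /= lte_fin ltr01 oppr0 adde0.
  by apply: le_measure; rewrite ?inE // => t [].
have Afin : lebesgue_measure A \is a fin_num.
  by rewrite ge0_fin_numE ?measure_ge0 // (le_lt_trans A1) ?ltry.
rewrite -(fineK Afin) lee_fin.
apply: alphaE_le; first by rewrite fine_ge0 // measure_ge0.
have [d d0 gd] := segment_uniformly_continuous _ g 0 1 e gc e0.
near=> n.
have n0 : (0 < n)%N by near: n; exact: nbhs_infty_gt.
have nR : 0 < (n%:R : R) by rewrite ltr0n.
have nd : n%:R^-1 < d.
  by rewrite invf_plt ?posrE //; near: n; exact: nbhs_infty_gtr.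
rewrite -lee_fin fineK //.
pose J := [pred j : 'I_n | 0 <= complex.Re (psum a N (expi (j%:R / n%:R : R)))].
apply: (@le_trans _ _ ((#|J|%:R / n%:R)%:E)).
  rewrite lee_fin ler_pM2r ?invr_gt0 // ler_nat.
  apply/bigmax_leqP => S /(circ_indep_inertia _ _ a) h.
  apply: (leq_trans h); rewrite subset_leq_card //; apply/fintype.subsetP => j.
  by rewrite !inE psum_trunc_set.
apply: card_div_le_measure => // j t Jj /andP[jt tj].
have j0 : 0 <= j%:R / n%:R :> R by rewrite divr_ge0.
have j1 : j.+1%:R / n%:R <= 1 :> R by rewrite ler_pdivrMr // mul1r ler_nat.
split => /=; first by rewrite in_itv /= (le_trans j0 jt) (lt_le_trans tj j1).
have : `|g (j%:R / n%:R) - g t| < e.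
  apply: gd; first by rewrite j0 (le_trans (ltW (le_lt_trans jt tj)) j1).
  rewrite distrC ger0_norm ?subr_ge0 //; apply: lt_trans nd.
  by rewrite ltrBlDr -[X in _ < X + _]mul1r -mulrDl nat1r.
have : `|complex.Re (psum a N (expi (j%:R / n%:R)) - f (expi (j%:R / n%:R)))| < e.
  by apply: le_lt_trans (Re_le_normc _ _) _; apply: fN; exact: normc_expi.
have -> : complex.Re (psum a N (expi (j%:R / n%:R)) - f (expi (j%:R / n%:R)))
   = complex.Re (psum a N (expi (j%:R / n%:R))) - g (j%:R / n%:R).
  by rewrite /g; case: (psum _ _ _) => ? ?; case: (f _).
have /= := Jj; move: (complex.Re (psum _ _ _)) => p p0.
rewrite !ltr_norml => /andP[h1 h2] /andP[h3 h4].
by lra.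
Unshelve. all: by end_near. Qed.

(** Continuity from above: the superlevel sets for thresholds increasing to 0 shrink to [{g >= 0}],
    which differs from [{g > 0}] by a null set. *)
Lemma alphaD_le_rho_plus (R : realType) (a : nat -> R[i]) (f : R[i] -> R[i]) :
  (forall z : R[i], on_circle z -> forall e : R, 0 < e ->
     exists2 d : R, 0 < d & forall w : R[i], on_circle w ->
       ComplexField.Normc.normc (w - z) < d -> ComplexField.Normc.normc (f w - f z) < e) ->
  (forall e : R, 0 < e -> exists N0 : nat, forall N : nat, (N0 <= N)%N ->
     forall z : R[i], on_circle z -> ComplexField.Normc.normc (psum a N z - f z) < e) ->
  lambdaT [set z | on_circle z /\ complex.Re (f z) = 0] = 0%E ->
  ((alphaD (fun k : nat => (0 < k)%N && (a k != 0)) : R)%:E <= rho_plus f)%E.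
Proof.
move=> /continuous_Re_expi; set g := (fun t : R => _) => gc fa Z.
set D := (fun k : nat => _).
have lamE (P : set R) : lambdaT [set z | on_circle z /\ P (complex.Re (f z))] =
    lebesgue_measure (`[0, 1[ `&` g @^-1` P).
  rewrite /lambdaT; congr (lebesgue_measure _).
  apply/seteqP; split => t /=; rewrite in_itv /=.
    by move=> [-> [_]].
  by move=> [-> ?]; do !split => //; exact: normc_expi.
have mP (P : set R) : measurable P -> measurable (`[0, 1[ `&` g @^-1` P).
  move=> ?; apply: measurableI => //; rewrite -[X in measurable X]setTI.
  exact: (measurable_realfun.continuous_measurable_fun gc).
(* The threshold is [e + e] for [e = 1 / k.+1]. *)
pose A k := `[0, 1[ `&` g @^-1` `[- (2 / k.+1%:R), +oo[.
have cA : bigcap setT A = (`[0, 1[ `&` g @^-1` [set x | 0 < x]) `|`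
    (`[0, 1[ `&` g @^-1` [set x | x = 0]).
  have A0 k : - (2 / k.+1%:R) <= 0 :> R by rewrite oppr_le0 divr_ge0.
  apply/seteqP; split => [t At|t [] [t01 gt] k _]; last 2 first.
  - by split=> //=; rewrite in_itv /= andbT; exact: le_trans (A0 k) (ltW gt).
  - by split=> //=; rewrite gt in_itv /= andbT; exact: A0.
  have t01 : `[0, 1[%classic t by have [] := At 0%N I.
  have {}At k : - (2 / k.+1%:R) <= g t.
    by have [_] := At k I; rewrite /= in_itv /= andbT.
  have [gt0|gt0|gt0] := ltgtP 0 (g t); [by left| |by right].
  (* If [x < 0], some [k] has [1 / k.+1 < - x / 2], against [- (2 / k.+1) <= x]. *)
  move: At gt0; move: (g t : R) => x At x0; exfalso.
  have x20 : 0 < - x / 2 by rewrite divr_gt0 // oppr_gt0.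
  have [k] := ltr_add_invr x20; have := At k; rewrite add0r.
  by move: (k.+1%:R^-1) => y; lra.
have muA : (lebesgue_measure \o A) x @[x --> \oo] --> lebesgue_measure (bigcap setT A).
  apply: nonincreasing_cvg_mu => //.
  - apply: (@le_lt_trans _ _ (lebesgue_measure (`[0, 1[%classic : set R))).
      by apply: le_measure; rewrite ?inE //; [exact: mP|move=> t []].
    by rewrite lebesgue_measure_itv /= lte_fin ltr01 ltry.
  - by move=> i; apply: mP.
  - by apply: bigcapT_measurable => i; apply: mP.
  - move=> n m nm; rewrite subsetEset => t [t01 /=]; rewrite !in_itv /= !andbT.
    split=> //=; rewrite in_itv /= andbT; apply: le_trans b.
    by rewrite lerN2 ler_pM2l // lef_pV2 ?posrE // ler_nat.
have -> : rho_plus f = lebesgue_measure (bigcap setT A).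
  rewrite /rho_plus (lamE [set x | 0 < x]) cA measureU0 //.
  - by apply: mP; rewrite -[X in measurable X]set_itvoy.
  - by apply: mP; exact: measurable_set1.
  - by rewrite -[LHS](lamE [set x | x = 0]).
apply: (cvge_ge _ muA); apply: nearW => k.
have k0 : 0 < k.+1%:R^-1 :> R by rewrite invr_gt0.
have [N0 hN] := fa _ k0.
(* The successor of [N0] is taken because the infimum runs over positive [n]; nonnegativity of
   [alphaE] supplies its lower bound. *)
apply: (@le_trans _ _ ((alphaE (trunc_set D N0.+1) : R)%:E)).
  rewrite lee_fin; apply: ge_inf; last by exists N0.+1.
  by exists 0 => _ [n _ <-]; exact: alphaE_ge0.
apply: le_trans (alphaE_trunc_le_measure _ a f _ _ gc k0 (hN _ (leqnSn _))) _.
rewrite le_eqVlt; apply/orP; left; apply/eqP; congr (lebesgue_measure _).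
congr (_ `&` _); apply/seteqP; split => t /=; rewrite in_itv /= andbT;
  by rewrite -mulr2n -[2]/(2%:R) mulr_natl.
Qed.

Theorem theorem5 (R : realType) (a : nat -> R[i]) (f : R[i] -> R[i]) :
  (* f is continuous on T *)
  (forall z : R[i], on_circle z -> forall e : R, 0 < e ->
     exists2 d : R, 0 < d & forall w : R[i], on_circle w ->
       ComplexField.Normc.normc (w - z) < d -> ComplexField.Normc.normc (f w - f z) < e) ->
  (* sum_{k>=1} a_k z^k converges uniformly on T to f *)
  (forall e : R, 0 < e -> exists N0 : nat, forall N : nat, (N0 <= N)%N ->
     forall z : R[i], on_circle z -> ComplexField.Normc.normc (psum a N z - f z) < e) ->
  (* lambda({z in T : Re f(z) = 0}) = 0 *)
  lambdaT [set z | on_circle z /\ complex.Re (f z) = 0] = 0%E ->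
  ((alphaD (fun k : nat => (0 < k)%N && (a k != 0)) : R)%:E
     <= Order.min (rho_plus f) (rho_minus f))%E.
Proof.
move=> fc fa Z; rewrite le_min alphaD_le_rho_plus //=.
have ReN z : complex.Re (- f z) = - complex.Re (f z) by case: (f z).
have -> : rho_minus f = rho_plus (fun z => - f z).
  rewrite /rho_minus /rho_plus; congr lambdaT.
  by apply/seteqP; split => z /=; rewrite ReN oppr_gt0.
(* Negating the series leaves its support, hence the distance set, unchanged. *)
have -> : (fun k => (0 < k)%N && (a k != 0)) = (fun k => (0 < k)%N && (- a k != 0)).
  by apply/funext => k; rewrite oppr_eq0.
apply: (alphaD_le_rho_plus _ (fun k => - a k) (fun z => - f z)).
- move=> z cz e e0; have [d d0 fd] := fc z cz e e0; exists d => // w cw wz.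
  by rewrite -opprD normcN; exact: fd.
- move=> e e0; have [N0 hN] := fa e e0; exists N0 => N NN z cz.
  have -> : psum (fun k => - a k) N z = - psum a N z.
    by rewrite /psum -sumrN; apply: eq_bigr => k _; rewrite mulNr.
  by rewrite -opprD normcN; exact: hN.
- rewrite -Z; congr lambdaT; apply/seteqP; split => z /=; rewrite ReN.
    by move=> [? /eqP]; rewrite oppr_eq0 => /eqP.
  by move=> [? ->]; rewrite oppr0.
Qed.
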